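(* Consider the constrained joint dynamics $$\frac{dy}{dt}=-\alpha\,P_{\mathcal{Q}}\bigl(\delta^T\delta\,x\bigr),\qquad \frac{d\delta}{dt}=-\beta\,\Pi_{\mathcal{M}}\bigl(\delta\,x\,x^T\bigr),\qquad x=\tilde u+\tilde y,\quad \alpha,\beta>0,$$ with initial condition $(y_0,\delta_0)$, and put $x_0=x(0)=\tilde u+\tilde y_0$. Assume that on $[0,T]$: 1. $\sup_{t\in[0,T]}\|\delta(t)\|_F\le B_\delta$ for some $B_\delta>0$; 2. the effective spectral gap $$\mu_{\mathrm{eff}}:=\inf_{t\in[0,T]}\frac{\|\Pi_{\mathcal{M}}(\delta(t)x(t)x(t)^T)\|_F^2}{\|\delta(t)x(t)\|^2}=\inf_{t\in[0,T]}\frac{\sum_{(v,e)\in\mathcal{I}}\|(\delta x)_e\|^2\|x_v\|^2}{\|\delta x\|^2}$$ is positive. Then $$\|x(T)-x(0)\|\le\frac{\alpha B_\delta\|\delta_0x_0\|}{\beta\mu_{\mathrm{eff}}}\bigl(1-e^{-\beta\mu_{\mathrm{eff}}T}\bigr)\le\frac{\alpha B_\delta\|\delta_0x_0\|}{\beta\mu_{\mathrm{eff}}}.$$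
   Context: Let $G=(V,E)$ be a finite connected graph. A discourse sheaf $\mathcal{F}$ on $G$ assigns finite-dimensional real inner product spaces $\mathcal{F}(v)$, $\mathcal{F}(e)$ to vertices and edges and linear restriction maps $\mathcal{F}_{v\unlhd e}:\mathcal{F}(v)\to\mathcal{F}(e)$ to incidences $v\in e$ (written $v\unlhd e$). $C^0=\bigoplus_v\mathcal{F}(v)$, $C^1=\bigoplus_e\mathcal{F}(e)$ with direct-sum inner products. For a fixed edge orientation the coboundary is $(\delta x)_e=\mathcal{F}_{v\unlhd e}(x_v)-\mathcal{F}_{u\unlhd e}(x_u)$ for $e=u\to v$. In the joint dynamics the stalks are fixed, but the restriction maps, encoded by the blocks of $\delta$ (the block from $\mathcal{F}(v)$ to $\mathcal{F}(e)$ is $\pm\mathcal{F}_{v\unlhd e}$, and blocks for non-incident pairs are zero), vary with time. $\|\cdot\|_F$ is the Frobenius norm. Stubborn opinions: $U\subseteq V$ is the set of stubborn vertices; each stalk splits orthogonally as $\mathcal{F}(v)=S_v\oplus T_v$ with $T_v=S_v^\perp$ and $S_v=\{0\}$ for $v\notin U$. $C^0(S)=\bigoplus_vS_v$, $C^0(\mathcal{Q})=\bigoplus_vT_v$; $P_{\mathcal{Q}}:C^0\to C^0(\mathcal{Q})$ is the orthogonal projection. $u\in C^0(S)$ is fixed (constant in time), $y(t)\in C^0(\mathcal{Q})$ evolves, and $\tilde u,\tilde y$ denote their inclusions in $C^0$. Adapting incidences: $\mathcal{I}\subseteq\{(v,e):v\unlhd e\}$. $\mathcal{M}$ is the space of linear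 maps $C^0\to C^1$ whose block from $\mathcal{F}(v)$ to $\mathcal{F}(e)$ vanishes unless $(v,e)\in\mathcal{I}$; $\Pi_{\mathcal{M}}$ is the orthogonal projection onto $\mathcal{M}$ in the Frobenius inner product. $\delta xx^T$ denotes the map $z\mapsto\langle x,z\rangle\,\delta x$. Convention: positivity of $\mu_{\mathrm{eff}}$ means that the ratio is bounded away from zero over those $t\in[0,T]$ with $\delta(t)x(t)\ne0$ (the infimum is over such $t$). If $\delta(t)x(t)=0$ at some time, the system is at equilibrium and the bound is understood to hold with zero displacement. *)

(* Defs.v *)
From HB Require Import structures.
From mathcomp Require Import all_boot all_order all_algebra.
From mathcomp Require Import all_classical all_reals all_analysis.

Set Implicit Arguments.
Unset Strict Implicit.
Unset Printing Implicit Defensive.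

Import Order.TTheory GRing.Theory Num.Theory.
Import numFieldNormedType.Exports VectorInternalTheory.

Local Open Scope classical_set_scope.
Local Open Scope ring_scope.

(* External direct sum of a finite family of finite-dimensional spaces. *)
Section DirectSum.
Context {R : realType} {I : finType}.
Variable F : I -> vectType R.

Definition dsum : Type := {dffun forall i : I, (F i : choiceType)}.

HB.instance Definition _ := Choice.copy dsum {dffun forall i : I, (F i : choiceType)}.

Definition mk_dsum (f : forall i, F i) : dsum := [ffun i => f i].

Definition dcomp (i : I) (x : dsum) : F i := x i.

Lemma mk_dsumE f i : dcomp i (mk_dsum f) = f i.
Proof. exact: ffunE. Qed.

Lemma dsumP (x y : dsum) : (forall i, dcomp i x = dcomp i y) <-> x = y.
Proof. by split=> [h|->//]; apply/ffunP. Qed.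

Definition dsum_add (x y : dsum) := mk_dsum (fun i => dcomp i x + dcomp i y).
Definition dsum_opp (x : dsum) := mk_dsum (fun i => - dcomp i x).
Definition dsum_scale (a : R) (x : dsum) := mk_dsum (fun i => a *: dcomp i x).
Definition dsum_zero := mk_dsum (fun i => 0).

Fact dsum_addA : associative dsum_add.
Proof. by move=> x y z; apply/dsumP => i; rewrite !mk_dsumE addrA. Qed.
Fact dsum_addC : commutative dsum_add.
Proof. by move=> x y; apply/dsumP => i; rewrite !mk_dsumE addrC. Qed.
Fact dsum_add0 : left_id dsum_zero dsum_add.
Proof. by move=> x; apply/dsumP => i; rewrite !mk_dsumE add0r. Qed.
Fact dsum_addN : left_inverse dsum_zero dsum_opp dsum_add.
Proof. by move=> x; apply/dsumP => i; rewrite !mk_dsumE addNr. Qed.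

HB.instance Definition _ :=
  GRing.isZmodule.Build dsum dsum_addA dsum_addC dsum_add0 dsum_addN.

Fact dsum_scaleA a b x : dsum_scale a (dsum_scale b x) = dsum_scale (a * b) x.
Proof. by apply/dsumP => i; rewrite !mk_dsumE scalerA. Qed.
Fact dsum_scale1 : left_id 1 dsum_scale.
Proof. by move=> x; apply/dsumP => i; rewrite !mk_dsumE scale1r. Qed.
Fact dsum_scaleDr : right_distributive dsum_scale +%R.
Proof. by move=> a x y; apply/dsumP => i; rewrite !mk_dsumE scalerDr. Qed.
Fact dsum_scaleDl x : {morph dsum_scale^~ x : a b / a + b}.
Proof. by move=> a b; apply/dsumP => i; rewrite !mk_dsumE scalerDl. Qed.

HB.instance Definition _ := GRing.Zmodule_isLmodule.Build R dsum
  dsum_scaleA dsum_scale1 dsum_scaleDr dsum_scaleDl.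

Lemma dcompD x y i : dcomp i (x + y) = dcomp i x + dcomp i y.
Proof. exact: mk_dsumE. Qed.
Lemma dcompZ a x i : dcomp i (a *: x) = a *: dcomp i x.
Proof. exact: mk_dsumE. Qed.

Fact dsum_vect_iso :
  Vector.axiom (\sum_(j < #|I|) dim (F (enum_val j))) dsum.
Proof.
exists (fun x => \mxrow_(j < #|I|) v2r (dcomp (enum_val j) x)).
  move=> a x y; apply/mxrowP => j; rewrite submxrowD.
  have -> (A : 'rV[R]_(\sum_(j < #|I|) dim (F (enum_val j)))) :
      submxrow (a *: A) j = a *: submxrow A j by apply/matrixP => k l; rewrite !mxE.
  by rewrite !mxrowK dcompD dcompZ linearP.
exists (fun w => mk_dsum (fun i =>
  ecast i (F i) (enum_rankK i) (r2v (submxrow w (enum_rank i))))).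
  move=> x; apply/dsumP => i; rewrite mk_dsumE mxrowK v2rK.
  by move: (enum_rankK i); move: (enum_val _) => k e; case: i / e.
move=> w; apply/mxrowP => j; rewrite mxrowK mk_dsumE.
apply: (canLR r2vK); move: (enum_rankK (enum_val j)).
by rewrite enum_valK => e; rewrite eq_axiomK.
Qed.

HB.instance Definition _ := Lmodule_hasFinDim.Build R dsum dsum_vect_iso.

Lemma dcomp_linear i : linear (dcomp i).
Proof. by move=> a x y; rewrite dcompD dcompZ. Qed.

Definition dsum_inj_fun (i : I) (a : F i) : dsum :=
  mk_dsum (fun j => if eqP : reflect (i = j) _ is ReflectT e
                    then ecast k (F k) e a else 0).

Lemma dsum_inj_linear i : linear (@dsum_inj_fun i).
Proof.
move=> a x y; apply/dsumP => j; rewrite dcompD dcompZ !mk_dsumE.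
by case: eqP => [e|_]; [case: _ / e | rewrite scaler0 addr0].
Qed.

HB.instance Definition _ i := GRing.isLinear.Build R dsum (F i) _
  (dcomp i) (dcomp_linear i).
HB.instance Definition _ i := GRing.isLinear.Build R (F i) dsum _
  (@dsum_inj_fun i) (@dsum_inj_linear i).

Definition dsum_proj i : 'Hom(dsum, F i) := linfun (dcomp i).
Definition dsum_inj i : 'Hom(F i, dsum) := linfun (@dsum_inj_fun i).

Lemma dsum_projE i x : dsum_proj i x = dcomp i x.
Proof. exact: lfunE. Qed.

Lemma dsum_inj_id i a : dcomp i (dsum_inj i a) = a.
Proof.
by rewrite lfunE mk_dsumE; case: eqP => // e; rewrite eq_axiomK.
Qed.

Lemma dsum_inj_neq i j a : i != j -> dcomp j (dsum_inj i a) = 0.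
Proof. by rewrite lfunE mk_dsumE; case: eqP. Qed.

Lemma dsum_sumE x : x = \sum_i dsum_inj i (dcomp i x).
Proof.
apply/dsumP => j; rewrite (raddf_sum (dcomp j)) (bigD1 j) //= dsum_inj_id.
by rewrite big1 ?addr0 // => i ij; rewrite dsum_inj_neq.
Qed.

Definition dsumv (S : forall i, {vspace F i}) : {vspace dsum} :=
  (\sum_i (dsum_inj i @: S i))%VS.

Lemma mem_dsumv S x : (x \in dsumv S) <-> (forall i, dcomp i x \in S i).
Proof.
split=> [/memv_sumP[f fS ->] i|xS].
  rewrite (raddf_sum (dcomp i)) (bigD1 i) //= big1 ?addr0.
    have /memv_imgP[a aS ->] := fS i isT; by rewrite dsum_inj_id.
  move=> j ji; have /memv_imgP[a _ ->] := fS j isT.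
  by rewrite dsum_inj_neq.
rewrite [x]dsum_sumE; apply/memv_sumP; exists (fun i => dsum_inj i (dcomp i x)) => //.
by move=> i _; apply: memv_img.
Qed.

Definition dsum_dot (ip : forall i, {dot (F i) for idfun}) (x y : dsum) : R :=
  \sum_i ip i (dcomp i x) (dcomp i y).

Section Dot.
Variable ip : forall i, {dot (F i) for idfun}.

Fact dsum_dot_bilinear : bilinear_for *%R (idfun \; *%R) (dsum_dot ip).
Proof.
split=> z a x y; rewrite /dsum_dot /= mulr_sumr -big_split; apply: eq_bigr => i _ /=.
  by rewrite dcompD dcompZ linearDl linearZl_LR.
by rewrite dcompD dcompZ linearDr linearZr_LR.
Qed.

HB.instance Definition _ := bilinear_isBilinear.Build R dsum dsum R *%R
  (idfun \; *%R) (dsum_dot ip) dsum_dot_bilinear.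

Fact dsum_dot_sym x y : dsum_dot ip x y = (-1) ^+ false * idfun (dsum_dot ip y x).
Proof.
rewrite expr0 mul1r; apply: eq_bigr => i _.
by rewrite (hermC (ip i)) expr0 mul1r.
Qed.

HB.instance Definition _ := isHermitianSesquilinear.Build R dsum false idfun
  (dsum_dot ip) dsum_dot_sym.

Fact dsum_dot_gt0 x : x != 0 -> 0 < dsum_dot ip x x.
Proof.
have ge0 i (a : F i) : 0 <= ip i a a.
  have [->|/neq0_dnorm_gt0/ltW//] := eqVneq a 0; by rewrite linear0r.
move=> x0; rewrite lt_neqAle sumr_ge0 // andbT eq_sym.
apply: contraNN x0; rewrite psumr_eq0 // => /allP h.
apply/eqP/dsumP => i; have := h i (mem_index_enum _).
rewrite (linear0 (dcomp i)); apply: contraTeq => xi /=.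
by rewrite gt_eqF // neq0_dnorm_gt0.
Qed.

HB.instance Definition _ := isDotProduct.Build R dsum (dsum_dot ip) dsum_dot_gt0.

End Dot.
End DirectSum.

Section InnerProduct.
Context {R : realType}.
Implicit Types V W : vectType R.

Definition dnorm V (ip : {dot V for idfun}) (x : V) : R := Num.sqrt (ip x x).

Lemma dotC V (ip : {dot V for idfun}) x y : ip x y = ip y x.
Proof. by rewrite hermC expr0 mul1r. Qed.

Lemma dot_ge0 V (ip : {dot V for idfun}) x : 0 <= ip x x.
Proof.
have [->|/neq0_dnorm_gt0/ltW//] := eqVneq x 0; by rewrite linear0r.
Qed.

Lemma dot_gt0 V (ip : {dot V for idfun}) x : x != 0 -> 0 < ip x x.
Proof. exact: neq0_dnorm_gt0. Qed.

Lemma dot_orthovP V (ip : {dot V for idfun}) (U : {vspace V}) x :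
  x \in orthov ip U <-> forall y, y \in U -> ip x y = 0.
Proof. by split=> [/mem_orthovP//|h]; apply/mem_orthovP. Qed.

Lemma onb_exists V (ip : {dot V for idfun}) (U : {vspace V}) :
  exists b : seq V, orthonormal ip b && basis_of U b.
Proof.
have [n] := ubnP (\dim U); elim: n U => // n IH U.
have [/eqP U0 _|U0 leU] := boolP (U == 0%VS).
  by exists [::]; rewrite U0 /orthonormal /= nil_basis.
have u0 : vpick U != 0 by rewrite vpick0.
set u := vpick U in u0.
have uu : 0 < ip u u by apply: neq0_dnorm_gt0.
set e := (Num.sqrt (ip u u))^-1 *: u.
have ee : ip e e = 1.
  rewrite linearZl_LR linearZr_LR /= mulrA -invfM -expr2 sqr_sqrtr ?ltW //.
  by rewrite mulVf ?gt_eqF.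
have eU : e \in U by rewrite rpredZ // memv_pick.
have eN : e \notin orthov ip U.
  by apply/negP => /dot_orthovP/(_ e eU) /eqP; rewrite ee oner_eq0.
have dimU := eq_dim_orthov1 eN.
have Ugt0 : (0 < \dim U)%N by rewrite lt0n dimv_eq0.
have [|b /andP[ob bb]] := IH (U :&: orthov ip <[e]>)%VS.
  by rewrite -dimU -ltnS prednK.
exists (e :: b); apply/andP; split.
  case/andP: ob => b1 b2; apply/andP; split; apply/andP; split=> //.
    by apply/eqP; exact: ee.
  apply/andP; split=> //; apply/allP => x /memv_span.
  rewrite (span_basis bb) memv_cap => /andP[_ /dot_orthovP/(_ e (memv_line e)) xe].
  by apply/eqP; rewrite -[RHS]xe; exact: dotC.
rewrite basisEdim; apply/andP; split; last first.
  move: bb; rewrite basisEdim => /andP[_]; rewrite -dimU /=.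
  by move: Ugt0; case: (\dim U).
apply/subvP => x xU; rewrite span_cons (span_basis bb).
rewrite -[x](subrK (ip x e *: e)) addrC memv_add //.
  by apply: rpredZ; exact: memv_line.
rewrite memv_cap rpredB //=; last by apply: rpredZ.
apply/dot_orthovP => _ /vlineP[k ->].
by rewrite linearZr_LR linearBl linearZl_LR /= ee mulr1 subrr mulr0.
Qed.

(* A chosen orthonormal basis: adjoint and frob below are independent of the
   choice, see adjointP and frobE. *)
Definition onb V (ip : {dot V for idfun}) : seq V := xchoose (onb_exists ip fullv).

Lemma onbP V (ip : {dot V for idfun}) :
  orthonormal ip (onb ip) /\ basis_of fullv (onb ip).
Proof. exact/andP/(xchooseP (onb_exists ip fullv)). Qed.

Lemma orthonormal_expand V (ip : {dot V for idfun}) (c : seq V) x :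
  orthonormal ip c -> basis_of fullv c -> x = \sum_(b <- c) ip x b *: b.
Proof.
case/andP=> /allP n1 po bb.
have : x \in span c by rewrite (span_basis bb) memvf.
elim: c n1 po x {bb} => [|b s IH] n1 /=.
  by move=> _ x; rewrite span_nil memv0 big_nil => /eqP.
case/andP=> /andP[/allP bs _] po x; rewrite span_cons big_cons.
case/memv_addP => _ /vlineP[k ->] [y ys ->].
have by0 z : z \in span s -> ip b z = 0.
  move=> /(coord_span (X := in_tuple s)) ->; rewrite linear_sumr big1 // => i _.
  rewrite linearZr_LR /=; have /eqP -> : ip b s`_i == 0 by apply/bs/mem_nth.
  by rewrite mulr0.
have bb1 : ip b b = 1 by apply/eqP/(n1 b)/mem_head.
rewrite linearDl linearZl_LR /= bb1 mulr1 (dotC ip y) by0 // addr0; congr (_ + _).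
rewrite [LHS](IH _ po) //; last by move=> z zs; apply: n1; rewrite inE zs orbT.
rewrite !big_seq; apply: eq_bigr => z zs.
by rewrite linearDl linearZl_LR /= (by0 z) ?memv_span // mulr0 add0r.
Qed.

Lemma onb_expand V (ip : {dot V for idfun}) x :
  x = \sum_(b <- onb ip) ip x b *: b.
Proof. by have [ob bb] := onbP ip; exact: orthonormal_expand. Qed.

Lemma linfunE V W (f : V -> W) : linear f -> forall x, linfun f x = f x.
Proof.
move=> lf x; pose fM := GRing.isLinear.Build R V W _ f lf.
by pose fL : {linear V -> W} := HB.pack f fM; exact: (lfunE fL x).
Qed.

Definition orthoproj V (ip : {dot V for idfun}) (U : {vspace V}) : 'End(V) :=
  daddv_pi U (orthov ip U).

Lemma orthov_cap V (ip : {dot V for idfun}) (U : {vspace V}) :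
  (U :&: orthov ip U = 0)%VS.
Proof.
apply/eqP; rewrite -subv0; apply/subvP => x; rewrite memv_cap memv0.
case/andP=> xU /dot_orthovP/(_ x xU) xx; apply: contraTT isT => x0.
by have := dot_gt0 ip x0; rewrite xx ltxx.
Qed.

Lemma orthonormal_coef V (ip : {dot V for idfun}) (b : seq V) (a : V -> R) c :
  orthonormal ip b -> c \in b -> ip (\sum_(d <- b) a d *: d) c = a c.
Proof.
case/andP=> /allP + +; elim: b => // d s IH n1 /= /andP[/andP[/allP ds _] po].
have d0 z : z \in s -> ip d z = 0 by move=> zs; apply/eqP; exact: ds.
rewrite inE big_cons linearDl linearZl_LR /= => /predU1P[->|cs].
  have -> : ip d d = 1 by apply/eqP/(n1 d)/mem_head.
  rewrite mulr1 linear_sumlz big_seq big1 ?addr0 // => z zs.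
  by rewrite linearZl_LR /= dotC d0 ?mulr0.
rewrite d0 // mulr0 add0r; apply: IH => // z zs.
by apply: n1; rewrite inE zs orbT.
Qed.

Lemma orthov_add V (ip : {dot V for idfun}) (U : {vspace V}) :
  (U + orthov ip U = fullv)%VS.
Proof.
apply/eqP; rewrite eqEsubv subvf; apply/subvP => x _.
have [b /andP[ob bb]] := onb_exists ip U.
set p := \sum_(c <- b) ip x c *: c.
have pU : p \in U.
  rewrite /p big_seq rpred_sum // => c cb; rewrite rpredZ //.
  by rewrite -(span_basis bb) memv_span.
rewrite -(subrK p x) addrC memv_add //; apply/dot_orthovP => y.
rewrite -(span_basis bb) => /(coord_span (X := in_tuple b)) ->.
rewrite linear_sumr big1 // => i _; rewrite linearZr_LR /=.
have bi : b`_i \in b by apply: mem_nth.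
have pb : ip p b`_i = ip x b`_i := orthonormal_coef (ip x) ob bi.
have -> : ip (x - p) b`_i = ip x b`_i - ip p b`_i by rewrite linearBl.
by rewrite pb subrr mulr0.
Qed.

Lemma orthoproj_mem V (ip : {dot V for idfun}) (U : {vspace V}) x :
  orthoproj ip U x \in U.
Proof. exact: memv_pi. Qed.

Lemma orthoproj_ortho V (ip : {dot V for idfun}) (U : {vspace V}) x y :
  y \in U -> ip (x - orthoproj ip U x) y = 0.
Proof.
move=> yU; rewrite /orthoproj -{1}[x](daddv_pi_add (orthov_cap ip U)); last first.
  by rewrite orthov_add memvf.
rewrite addrAC subrr add0r.
by have /dot_orthovP/(_ y yU) := memv_pi (orthov ip U) U x.
Qed.

Definition adjoint V W (ipV : {dot V for idfun}) (ipW : {dot W for idfun})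
    (f : 'Hom(V, W)) : 'Hom(W, V) :=
  linfun (fun w => \sum_(b <- onb ipV) ipW w (f b) *: b).

Lemma adjointP V W (ipV : {dot V for idfun}) (ipW : {dot W for idfun})
    (f : 'Hom(V, W)) x w :
  ipV x (adjoint ipV ipW f w) = ipW (f x) w.
Proof.
rewrite linfunE; last first.
  move=> a y z; rewrite scaler_sumr -big_split; apply: eq_bigr => b _ /=.
  by rewrite linearDl linearZl_LR scalerDl scalerA.
rewrite {2}[x](onb_expand ipV) (linear_sum f) linear_sumr linear_sumlz.
apply: eq_bigr => b _.
by rewrite (linearZ_LR f) linearZr_LR linearZl_LR /= mulrC (dotC ipW).
Qed.

Definition frob V W (ipV : {dot V for idfun}) (ipW : {dot W for idfun})
    (f g : 'Hom(V, W)) : R :=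
  \sum_(b <- onb ipV) ipW (f b) (g b).

Section Frob.
Variables (V W : vectType R) (ipV : {dot V for idfun}) (ipW : {dot W for idfun}).
Local Notation frobVW := (frob ipV ipW).

Fact frob_bilinear : bilinear_for *%R (idfun \; *%R) frobVW.
Proof.
split=> z a x y; rewrite /frob /= mulr_sumr -big_split; apply: eq_bigr => b _ /=.
  by rewrite add_lfunE scale_lfunE linearDl linearZl_LR.
by rewrite add_lfunE scale_lfunE linearDr linearZr_LR.
Qed.

HB.instance Definition _ := bilinear_isBilinear.Build R 'Hom(V, W) 'Hom(V, W) R *%R
  (idfun \; *%R) frobVW frob_bilinear.

Fact frob_sym f g : frobVW f g = (-1) ^+ false * idfun (frobVW g f).
Proof. by rewrite expr0 mul1r; apply: eq_bigr => b _; rewrite dotC. Qed.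

HB.instance Definition _ := isHermitianSesquilinear.Build R 'Hom(V, W) false idfun
  frobVW frob_sym.

Fact frob_gt0 f : f != 0 -> 0 < frobVW f f.
Proof.
move=> f0; rewrite lt_neqAle sumr_ge0 => [|b _]; last exact: dot_ge0.
rewrite andbT eq_sym; apply: contraNN f0.
rewrite psumr_eq0 => [|b _]; last exact: dot_ge0.
move=> /allP h; apply/eqP/lfunP => x; rewrite zero_lfunE [x](onb_expand ipV).
rewrite linear_sum big_seq big1 // => b /h /=; rewrite linearZ /= => fb.
have [->|fb0] := eqVneq (f b) 0; first by rewrite scaler0.
by have := dot_gt0 ipW fb0; rewrite (eqP fb) ltxx.
Qed.

HB.instance Definition _ := isDotProduct.Build R 'Hom(V, W) frobVW frob_gt0.

Lemma frobE (c : seq V) f g : orthonormal ipV c -> basis_of fullv c ->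
  frobVW f g = \sum_(b <- c) ipW (f b) (g b).
Proof.
move=> oc bc; rewrite /frob.
under eq_bigr => b _.
  rewrite {1}(orthonormal_expand b oc bc) (linear_sum f) linear_sumlz.
  under eq_bigr => d _ do rewrite (linearZ_LR f) linearZl_LR /=.
  over.
rewrite exchange_big; apply: eq_bigr => d _ /=.
rewrite {4}[d](onb_expand ipV) (linear_sum g) linear_sumr; apply: eq_bigr => b _.
by rewrite (linearZ_LR g) linearZr_LR /= (dotC ipV d b).
Qed.

End Frob.

(* The map z |-> <x, z> w, written w x^T. *)
Definition outer V W (ipV : {dot V for idfun}) (w : W) (x : V) : 'Hom(V, W) :=
  linfun (fun z => ipV x z *: w).

Lemma outerE V W (ipV : {dot V for idfun}) (w : W) x z :
  outer ipV w x z = ipV x z *: w.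
Proof.
apply: linfunE => a y {}z.
by rewrite linearDr linearZr_LR scalerDl scalerA.
Qed.

End InnerProduct.

(* Differentiability relative to A, in the norm of ip: on an interval the
   derivative is one-sided at the end points. *)
Definition has_derivative_in {R : realType} (V : vectType R)
    (ip : {dot V for idfun}) (A : set R) (x : R -> V) (t : R) (w : V) : Prop :=
  dnorm ip ((s - t)^-1 *: (x s - x t) - w) @[s --> within A t^'] --> (0 : R).

(* Parallel edges are allowed, loops are not. *)
Record graph := Graph {
  vertex : finType;
  edge : finType;
  ends : edge -> {set vertex};
  card_ends : forall e, #|ends e| = 2%N }.

Definition adjacent (G : graph) : rel (vertex G) :=
  fun v w => [exists e : edge G, ends e == [set v; w]%SET].

Definition connected_graph (G : graph) : Prop :=
  forall v w : vertex G, fingraph.connect (@adjacent G) v w.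

Record orientation (G : graph) := Orientation {
  src : edge G -> vertex G;
  tgt : edge G -> vertex G;
  ends_src_tgt : forall e, ends e = [set src e; tgt e]%SET }.

Lemma src_ends (G : graph) (o : orientation G) e : src o e \in ends e.
Proof. by rewrite (ends_src_tgt o) finset.set21. Qed.

Lemma tgt_ends (G : graph) (o : orientation G) e : tgt o e \in ends e.
Proof. by rewrite (ends_src_tgt o) finset.set22. Qed.

Record stalks (R : realType) (G : graph) := Stalks {
  vstalk : vertex G -> vectType R;
  estalk : edge G -> vectType R;
  vdot : forall v, {dot (vstalk v) for idfun};
  edot : forall e, {dot (estalk e) for idfun} }.

Notation C0 F := (dsum (vstalk F)).
Notation C1 F := (dsum (estalk F)).

Section Sheaf.
Context {R : realType} {G : graph}.
Variable F : stalks R G.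

(* A discourse sheaf is a choice of stalks together with restriction maps,
   which are kept apart because only the latter evolve. *)
Definition restriction_maps : Type :=
  forall (v : vertex G) (e : edge G), v \in ends e -> 'Hom(vstalk F v, estalk F e).

Definition dotC0 : {dot C0 F for idfun} := dsum_dot (vdot F).
Definition dotC1 : {dot C1 F for idfun} := dsum_dot (edot F).
Definition dotF : {dot 'Hom(C0 F, C1 F) for idfun} := frob dotC0 dotC1.

Definition coboundary (o : orientation G) (rho : restriction_maps) : 'Hom(C0 F, C1 F) :=
  linfun (fun x : C0 F => mk_dsum (fun e =>
    rho (tgt o e) e (tgt_ends o e) (dcomp (tgt o e) x)
    - rho (src o e) e (src_ends o e) (dcomp (src o e) x)) : C1 F).

Lemma coboundaryE o rho x e :
  dcomp e (coboundary o rho x) =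
    rho (tgt o e) e (tgt_ends o e) (dcomp (tgt o e) x)
    - rho (src o e) e (src_ends o e) (dcomp (src o e) x).
Proof.
rewrite /coboundary linfunE ?mk_dsumE // => a y z; apply/dsumP => {}e.
by rewrite [RHS]linearP !mk_dsumE !linearP /= !mk_dsumE addrACA -scalerDr.
Qed.

Definition block (v : vertex G) (e : edge G) (f : 'Hom(C0 F, C1 F)) :
    'Hom(vstalk F v, estalk F e) :=
  (dsum_proj (estalk F) e \o f \o dsum_inj (vstalk F) v)%VF.

Lemma block_linear v e : linear (block v e).
Proof.
move=> a f g; apply/lfunP => x.
by rewrite !(add_lfunE, scale_lfunE, comp_lfunE) linearP.
Qed.

(* The space M of maps whose (v, e) block vanishes unless (v, e) \in I. *)
Definition adapting_maps (I : {set vertex G * edge G}) : {vspace 'Hom(C0 F, C1 F)} :=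
  (\bigcap_(p | p \notin I) lker (linfun (block p.1 p.2)))%VS.

Lemma mem_adapting_maps I f :
  f \in adapting_maps I <-> (forall v e, (v, e) \notin I -> block v e f = 0).
Proof.
have memE v e : (f \in lker (linfun (block v e))) = (block v e f == 0).
  by rewrite memv_ker linfunE //; exact: block_linear.
rewrite memvE; split=> [/subv_bigcapP h v e ve|h].
  by apply/eqP; rewrite -memE memvE; exact: (h (v, e) ve).
by apply/subv_bigcapP => -[v e] ve; rewrite -memvE memE; apply/eqP/h.
Qed.

Definition Pi_M (I : {set vertex G * edge G}) : 'End('Hom(C0 F, C1 F)) :=
  orthoproj dotF (adapting_maps I).

Section Stubborn.
Variable S : forall v, {vspace vstalk F v}.

Definition C0_S : {vspace C0 F} := dsumv S.
Definition C0_Q : {vspace C0 F} := dsumv (fun v => orthov (vdot F v) (S v)).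
Definition P_Q : 'End(C0 F) := orthoproj dotC0 C0_Q.

End Stubborn.

(* The infimum is extended-real: it is +oo, hence positive, exactly when
   delta t (x t) vanishes throughout [0, T]. *)
Definition mu_eff (I : {set vertex G * edge G}) (T : R)
    (x : R -> C0 F) (delta : R -> 'Hom(C0 F, C1 F)) : \bar R :=
  ereal_inf [set (dnorm dotF (Pi_M I (outer dotC0 (delta t (x t)) (x t))) ^+ 2
                  / dnorm dotC1 (delta t (x t)) ^+ 2)%:E
            | t in [set t | 0 <= t <= T /\ delta t (x t) != 0]].

Definition mu_eff_sum (I : {set vertex G * edge G}) (T : R)
    (x : R -> C0 F) (delta : R -> 'Hom(C0 F, C1 F)) : \bar R :=
  ereal_inf [set ((\sum_(p in I) dnorm (edot F p.2) (dcomp p.2 (delta t (x t))) ^+ 2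
                                 * dnorm (vdot F p.1) (dcomp p.1 (x t)) ^+ 2)
                  / dnorm dotC1 (delta t (x t)) ^+ 2)%:E
            | t in [set t | 0 <= t <= T /\ delta t (x t) != 0]].

End Sheaf.

(* Main.v *)
Require Import Defs.
From HB Require Import structures.
From mathcomp Require Import all_boot all_order all_algebra.
From mathcomp Require Import all_classical all_reals all_analysis.
From mathcomp Require Import ring lra.

Set Implicit Arguments.
Unset Strict Implicit.
Unset Printing Implicit Defensive.

Import Order.TTheory GRing.Theory Num.Theory.
Import numFieldNormedType.Exports.

Local Open Scope classical_set_scope.
Local Open Scope ring_scope.

(** Write z = delta x for the disagreement and phi = |z|^2 for the energy.  Both
   flows dissipate phi: since <z, A x> is the Frobenius product of z x^T with A,
   and since orthogonal projections P satisfy <v, P v> = |P v|^2,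

     phi' = - 2 beta |Pi_M (z x^T)|^2 - 2 alpha |P_Q (delta^T z)|^2
                                                        [energy_derivative].

   The spectral gap makes the first term at most - 2 beta mu phi, so phi decays
   like exp (- 2 beta mu t) [energy_gronwall].  The speed of x is
   alpha |P_Q (delta^T z)|, which is at most alpha B |z| because the Frobenius norm
   dominates the operator norm [grad_le]; it therefore decays like
   exp (- beta mu t), and integrating it bounds the displacement
   [displacement_le].  The integration is done on the scalar function <x, w> with
   w = x(T) - x(0), so that no vector-valued integral is involved.

   If z vanishes at one time, phi vanishes afterwards because it decreases.  It
   also vanished before: x is bounded on [0, T], so both dissipation terms are at
   most a constant multiple of phi, and phi cannot reach zero from a positive value
   in finite time [energy_backward].  Hence x never moves.

   The two forms of the effective gap agree at each time because Pi_M (z x^T) is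
   explicit: it keeps the blocks z_e x_v^T of the adapting incidences (v, e), and
   these are pairwise orthogonal [Pi_M_outer, dnorm_Pi_M_outer].

   The derivatives in the hypotheses are one-sided at 0 and T.  Each estimate is
   reduced to the monotonicity of a real function that is continuous on [0, T] and
   differentiable in the interior; continuity carries it to the end points. *)

(** * The norm of an inner product *)

Section InnerProductNorm.
Context {R : realType} (V : vectType R) (ip : {dot V for idfun}).
Implicit Types (x y : V) (a : R).

Lemma dnorm_sqr x : dnorm ip x ^+ 2 = ip x x.
Proof. by rewrite sqr_sqrtr ?dot_ge0. Qed.

Lemma dnorm_nneg x : 0 <= dnorm ip x.
Proof. exact: sqrtr_ge0. Qed.

Lemma dotDl x y z : ip (x + y) z = ip x z + ip y z.
Proof. exact: linearDl. Qed.

Lemma dotDr x y z : ip x (y + z) = ip x y + ip x z.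
Proof. exact: linearDr. Qed.

Lemma dotZl a x y : ip (a *: x) y = a * ip x y.
Proof. exact: linearZl_LR. Qed.

Lemma dotZr a x y : ip x (a *: y) = a * ip x y.
Proof. exact: linearZr_LR. Qed.

Lemma dotBl x y z : ip (x - y) z = ip x z - ip y z.
Proof. by rewrite -scaleN1r dotDl dotZl mulN1r. Qed.

Lemma dot_sumr (J : Type) (r : seq J) (P : pred J) x (f : J -> V) :
  ip x (\sum_(j <- r | P j) f j) = \sum_(j <- r | P j) ip x (f j).
Proof. exact: linear_sumr. Qed.

Lemma dot_suml (J : Type) (r : seq J) (P : pred J) x (f : J -> V) :
  ip (\sum_(j <- r | P j) f j) x = \sum_(j <- r | P j) ip (f j) x.
Proof. exact: linear_sumlz. Qed.

Lemma dot0l x : ip 0 x = 0.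
Proof. by rewrite -(scale0r 0) dotZl mul0r. Qed.

Lemma dnorm_scale a x : dnorm ip (a *: x) = `|a| * dnorm ip x.
Proof.
by rewrite /dnorm dotZl dotZr mulrA -expr2 sqrtrM ?sqr_ge0 // sqrtr_sqr.
Qed.

Lemma dnorm_vec0 : dnorm ip 0 = 0.
Proof. by rewrite -(scale0r 0) dnorm_scale normr0 mul0r. Qed.

Lemma dnorm_vec0P x : dnorm ip x = 0 -> x = 0.
Proof.
move=> nx; apply/eqP; apply: contraT => /(dot_gt0 ip).
by rewrite -dnorm_sqr nx expr0n ltxx.
Qed.

(** The Cauchy-Schwarz inequality, from the nonnegativity of the square of
   |y| x - |x| y. *)
Lemma dot_le_dnorm x y : ip x y <= dnorm ip x * dnorm ip y.
Proof.
have [->|y0] := eqVneq y 0.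
  by rewrite dotC dot0l mulr_ge0 // dnorm_nneg.
have ny : 0 < dnorm ip y by rewrite sqrtr_gt0 dot_gt0.
have : 0 <= ip (dnorm ip y *: x - dnorm ip x *: y) (dnorm ip y *: x - dnorm ip x *: y).
  exact: dot_ge0.
rewrite dotBl !(dotC ip _ (_ - _)) !dotBl !dotZl !dotZr -!dnorm_sqr (dotC ip y x).
have := dnorm_nneg x; set nx := dnorm ip x; set b := dnorm ip y in ny *.
set c := ip x y; move=> nx0 h.
have {}h : 0 <= nx * b * (nx * b - c) by nra.
have [nx1|nx1] := eqVneq nx 0; last first.
  rewrite -subr_ge0; rewrite pmulr_rge0 // in h.
  by rewrite mulr_gt0 // lt_neqAle eq_sym nx1.
by rewrite /c (dnorm_vec0P nx1) dot0l nx1 mul0r.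
Qed.

Lemma dnorm_tri x y : dnorm ip (x + y) <= dnorm ip x + dnorm ip y.
Proof.
rewrite -(ler_pXn2r (n := 2)) // ?nnegrE ?addr_ge0 ?dnorm_nneg //.
rewrite dnorm_sqr dotDl !dotDr sqrrD !dnorm_sqr (dotC ip y x).
by have := dot_le_dnorm x y; lra.
Qed.

Lemma ler_abs_dot x y : `|ip x y| <= dnorm ip x * dnorm ip y.
Proof.
rewrite ler_norml dot_le_dnorm andbT.
have := dot_le_dnorm (-1 *: x) y; rewrite dotZl dnorm_scale normrN1; lra.
Qed.

End InnerProductNorm.

(** * Differentiation relative to a set *)

Section Derivative.
Context {R : realType}.

Lemma has_derivative_in_cst (V : vectType R) (ip : {dot V for idfun}) A t (c : V) :
  has_derivative_in ip A (fun=> c) t 0.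
Proof.
rewrite /has_derivative_in; under eq_fun do rewrite subrr scaler0 subrr dnorm_vec0.
exact: cvg_cst.
Qed.

Lemma has_derivative_in_addl (V : vectType R) (ip : {dot V for idfun}) A t (c : V) f w :
  has_derivative_in ip A f t w -> has_derivative_in ip A (fun s => c + f s) t w.
Proof.
by rewrite /has_derivative_in; under [in X in _ -> X]eq_fun do rewrite opprD addrACA subrr add0r.
Qed.

Lemma has_derivative_in_cvg (V : vectType R) (ip : {dot V for idfun}) A f t w :
  has_derivative_in ip A f t w ->
  dnorm ip (f s - f t) @[s --> within A t^'] --> (0 : R).
Proof.
move=> df.
have cst : (s - t) @[s --> within A t^'] --> (0 : R).
  rewrite -(subrr t); do 2!apply: cvg_within_filter.
  by apply: cvgB; [exact: cvg_id|exact: cvg_cst].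
have : `|s - t| * (dnorm ip ((s - t)^-1 *: (f s - f t) - w) + dnorm ip w)
    @[s --> within A t^'] --> `|0 : R| * (0 + dnorm ip w).
  apply: cvgM; first exact: cvg_norm.
  by apply: cvgD => //; exact: cvg_cst.
rewrite normr0 mul0r; move=> lim0; apply: (squeeze_cvgr _ (cvg_cst _) lim0).
apply: nearW => s; rewrite dnorm_nneg /=.
have [->|st] := eqVneq s t; first by rewrite !subrr normr0 mul0r dnorm_vec0.
apply: le_trans (_ : `|s - t| * dnorm ip ((s - t)^-1 *: (f s - f t)) <= _).
  by rewrite -dnorm_scale scalerA divff ?scale1r // subr_eq0.
rewrite ler_wpM2l //; apply: le_trans (dnorm_tri _ _ _).
by rewrite subrK.
Qed.

(** The Leibniz rule for a bilinear map B bounded by the product of the norms.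
   Its two uses take values in a space normed by an inner product (B is the
   application of a linear map) and in the reals (B is an inner product), so the
   target only carries a subadditive N. *)
Lemma product_rule_in (V1 V2 : vectType R) (W : lmodType R)
    (ip1 : {dot V1 for idfun}) (ip2 : {dot V2 for idfun}) (N : W -> R)
    (B : V1 -> V2 -> W) A f g t f' g' :
  (forall w, 0 <= N w) -> (forall w z, N (w + z) <= N w + N z) ->
  (forall b, linear (B^~ b)) -> (forall a, linear (B a)) ->
  (forall a b, N (B a b) <= dnorm ip1 a * dnorm ip2 b) ->
  has_derivative_in ip1 A f t f' -> has_derivative_in ip2 A g t g' ->
  N ((s - t)^-1 *: (B (f s) (g s) - B (f t) (g t)) - (B f' (g t) + B (f t) g'))
    @[s --> within A t^'] --> (0 : R).
Proof.
move=> N0 ND Bl Br BN df dg; have cg := has_derivative_in_cvg dg.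
have BZl c a b : B (c *: a) b = c *: B a b by exact: (scalable_linear (Bl b)).
have BZr c a b : B a (c *: b) = c *: B a b by exact: (scalable_linear (Br a)).
have BBl a a' b : B (a - a') b = B a b - B a' b by exact: (additive_linear (Bl b)).
have BBr a b b' : B a (b - b') = B a b - B a b' by exact: (additive_linear (Br a)).
pose q (V : vectType R) (h : R -> V) s := (s - t)^-1 *: (h s - h t).
have : dnorm ip1 (q _ f s - f') * (dnorm ip2 (g s - g t) + dnorm ip2 (g t))
    + dnorm ip1 f' * dnorm ip2 (g s - g t) + dnorm ip1 (f t) * dnorm ip2 (q _ g s - g')
    @[s --> within A t^'] -->
    0 * (0 + dnorm ip2 (g t)) + dnorm ip1 f' * 0 + dnorm ip1 (f t) * (0 : R).
  apply: cvgD; first apply: cvgD; apply: cvgM => //; try exact: cvg_cst.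
  by apply: cvgD => //; exact: cvg_cst.
rewrite mul0r !mulr0 !addr0; move=> lim0; apply: (squeeze_cvgr _ (cvg_cst _) lim0).
apply: nearW => s; rewrite N0 /=.
(* The error of B (f s) (g s) splits into the errors of the two difference
   quotients and a term that only needs the continuity of g. *)
have -> : (s - t)^-1 *: (B (f s) (g s) - B (f t) (g t)) - (B f' (g t) + B (f t) g')
    = B (q _ f s - f') (g s) + B f' (g s - g t) + B (f t) (q _ g s - g').
  rewrite /q !(BBl, BBr, BZl, BZr) subrKA addrACA -opprD -!scalerDr.
  by rewrite subrKA.
apply: le_trans (ND _ _) _; rewrite lerD ?BN //.
apply: le_trans (ND _ _) _; rewrite lerD ?BN //.
apply: le_trans (BN _ _) _; rewrite ler_wpM2l ?dnorm_nneg //.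
by apply: le_trans (dnorm_tri _ _ _); rewrite subrK.
Qed.

Definition real_derivative_in (A : set R) (f : R -> R) (t l : R) : Prop :=
  (s - t)^-1 * (f s - f t) @[s --> within A t^'] --> l.

Lemma real_derivative_in_dot (V : vectType R) (ip : {dot V for idfun}) A f g t f' g' :
  has_derivative_in ip A f t f' -> has_derivative_in ip A g t g' ->
  real_derivative_in A (fun s => ip (f s) (g s)) t (ip f' (g t) + ip (f t) g').
Proof.
move=> df dg.
have h := @product_rule_in V V R^o ip ip Num.norm (fun a b => ip a b) A f g t f' g'
  (@normr_ge0 _ _) (@ler_normD _ _) _ _ (@ler_abs_dot _ _ ip) df dg.
have linl b : linear (ip^~ b) by move=> c x y; rewrite /= dotDl dotZl.
have linr a : linear [eta ip a] by move=> c x y; rewrite /= dotDr dotZr.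
apply/subr_cvg0; exact: norm_cvg0 (h linl linr).
Qed.

End Derivative.

(** * Differential inequalities on a segment *)

Section RealDerivative.
Context {R : realType}.
Implicit Types (f g l : R -> R) (a b k t T : R).

Lemma real_derivative_inN (A : set R) f t (l : R) :
  real_derivative_in A f t l -> real_derivative_in A (fun s => - f s) t (- l).
Proof.
rewrite /real_derivative_in => /cvgN.
rewrite [X in _ -> X @ _ --> _](_ : _ = - (fun s => (s - t)^-1 * (f s - f t))) //.
by apply/funext => s; rewrite -opprD mulrN.
Qed.

Lemma real_derivative_in_continuous T f l :
  (forall t, 0 <= t <= T -> real_derivative_in [set s | 0 <= s <= T] f t (l t)) ->
  {within `[0, T], continuous f}.
Proof.
move=> df; apply/subspace_continuousP => t /=; rewrite in_itv /= => tT P Pft.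
have := df t tT; rewrite /real_derivative_in => cq.
have ct : (s - t) @[s --> within [set s | 0 <= s <= T] t^'] --> (0 : R).
  rewrite -(subrr t); do 2!apply: cvg_within_filter.
  by apply: cvgB; [exact: cvg_id|exact: cvg_cst].
have : f t + (s - t) * ((s - t)^-1 * (f s - f t))
    @[s --> within [set s | 0 <= s <= T] t^'] --> f t.
  have := cvgD (cvg_cst (f t)) (cvgM ct cq).
  by rewrite mul0r addr0; apply.
move=> /(_ P Pft) nP.
have {}nP : \forall s \near t, s != t -> 0 <= s <= T ->
    P (f t + (s - t) * ((s - t)^-1 * (f s - f t))) by exact: nP.
suff sP : \forall s \near t, s \in `[0, T] -> P (f s) by exact: sP.
apply: filterS nP => s /= nP; rewrite in_itv /= => sT.
have [->|st] := eqVneq s t; first exact: nbhs_singleton.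
by have := nP st sT; rewrite mulrA divff ?subr_eq0 // mul1r addrC subrK.
Qed.

Lemma real_derivative_in_interior T f t (l : R) :
  0 < t < T -> real_derivative_in [set s | 0 <= s <= T] f t l ->
  is_derive t 1 f l.
Proof.
move=> /andP[t0 tT] df.
have lim : h^-1 *: (f (h *: 1 + t) - f t) @[h --> 0^'] --> l.
  move=> P /df /nbhs_ballP[e /= e0 eP].
  apply/nbhs_ballP; exists (Num.min e (Num.min t (T - t))).
    by rewrite /= !lt_min e0 t0 subr_gt0.
  move=> h; rewrite /ball /= sub0r normrN !lt_min => /and3P[he ht hT] h0.
  have := eP (h + t); rewrite /ball /= opprD addrCA subrr addr0 normrN => /(_ he).
  rewrite [h *: 1]mulr1 addrK; apply.
    by rewrite -subr_eq0 addrK.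
  by move: ht hT; rewrite !ltr_norml => /andP[? ?] /andP[? ?]; apply/andP; split; lra.
by apply: DeriveDef; [apply/cvg_ex; exists l|exact: cvg_lim lim].
Qed.

Lemma is_derive_nincr T f l a b :
  {within `[0, T], continuous f} ->
  (forall t, 0 < t < T -> is_derive t 1 f (l t)) ->
  (forall t, 0 < t < T -> l t <= 0) ->
  0 <= a -> a <= b -> b <= T -> f b <= f a.
Proof.
move=> cf df l0 a0 ab bT; apply: (ler0_derive1_le_cc _ _ cf) => //.
- by move=> t; rewrite in_itv /= => /df [].
- by move=> t; rewrite in_itv /= => tT; rewrite derive1E (@derive_val _ _ _ _ _ _ _ (df t tT)) l0.
- by rewrite in_itv /= bT (le_trans a0).
- by rewrite in_itv /= a0 (le_trans ab).
Qed.

Lemma is_derive_expR_scale k t : is_derive t 1 (fun s => expR (k * s)) (k * expR (k * t)).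
Proof. by apply: is_derive_eq; rewrite /= !scaler1 mulrC. Qed.

(** The integrating factor expR (k * t) turns the inequality l <= - k f into the
   statement that f * expR (k * t) has a nonpositive derivative. *)
Lemma gronwall_in T f l k a b :
  (forall t, 0 <= t <= T -> real_derivative_in [set s | 0 <= s <= T] f t (l t)) ->
  (forall t, 0 <= t <= T -> l t + k * f t <= 0) ->
  0 <= a -> a <= b -> b <= T -> f b * expR (k * b) <= f a * expR (k * a).
Proof.
move=> df lk; pose L t := f t * (k * expR (k * t)) + expR (k * t) * l t.
apply: (@is_derive_nincr T (f * (fun s => expR (k * s))) L).
- move=> t; apply: continuousM; first exact: real_derivative_in_continuous df t.
  apply: derivable_within_continuous => {}t _.
  by have [] := is_derive_expR_scale k t.
- move=> t /[dup] tT /andP[/ltW t0 /ltW t1].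
  apply: is_deriveM; last exact: is_derive_expR_scale.
  by apply: real_derivative_in_interior tT (df _ _); rewrite t0.
- move=> t /andP[/ltW t0 /ltW t1]; have := lk t; rewrite t0 t1 => /(_ isT).
  have : 0 < expR (k * t) by exact: expR_gt0.
  by rewrite /L; nra.
Qed.

Lemma comparison_in T f l g dg a b :
  (forall t, 0 <= t <= T -> real_derivative_in [set s | 0 <= s <= T] f t (l t)) ->
  (forall t, is_derive t 1 g (dg t)) ->
  (forall t, 0 <= t <= T -> l t <= dg t) ->
  0 <= a -> a <= b -> b <= T -> f b - f a <= g b - g a.
Proof.
move=> df dgP ldg a0 ab bT.
suff : f b - g b <= f a - g a by lra.
apply: (@is_derive_nincr T (f - g) (fun t => l t - dg t)) => //.
- apply: within_continuousB; first exact: real_derivative_in_continuous df.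
  apply: derivable_within_continuous => t _.
  by have [] := dgP t.
- move=> t /[dup] tT /andP[/ltW t0 /ltW t1].
  apply: is_deriveB.
  by apply: real_derivative_in_interior tT (df _ _); rewrite t0.
- by move=> t /andP[/ltW t0 /ltW t1]; rewrite subr_le0 ldg ?t0.
Qed.

End RealDerivative.

(** * Rank-one maps, adjoints and projections *)

Section Outer.
Context {R : realType} (V W : vectType R).
Context (ipV : {dot V for idfun}) (ipW : {dot W for idfun}).
Implicit Types (x : V) (w : W) (A : 'Hom(V, W)).

(** Rank-one maps represent the functionals A |-> <w, A x>.  This is how the
   bounds below and the energy identity reduce to the Frobenius inner product. *)
Lemma frob_outer w x A : frob ipV ipW (outer ipV w x) A = ipW w (A x).
Proof.
rewrite [X in A X](onb_expand ipV) (linear_sum A) dot_sumr /frob.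
by apply: eq_bigr => b _; rewrite outerE dotZl linearZ dotZr.
Qed.

Lemma dnorm_outer w x : dnorm (frob ipV ipW) (outer ipV w x) = dnorm ipW w * dnorm ipV x.
Proof.
transitivity (Num.sqrt (ipW w (outer ipV w x x))); first by congr Num.sqrt; exact: frob_outer.
by rewrite outerE dotZr mulrC sqrtrM ?dot_ge0.
Qed.

(** Cauchy-Schwarz for the pairing of A with the rank-one map built from A x and x. *)
Lemma dnorm_apply A x : dnorm ipW (A x) <= dnorm (frob ipV ipW) A * dnorm ipV x.
Proof.
have [->|Ax0] := eqVneq (A x) 0.
  by rewrite dnorm_vec0 mulr_ge0 ?dnorm_nneg.
have nAx : 0 < dnorm ipW (A x) by rewrite sqrtr_gt0 dot_gt0.
rewrite -(ler_pM2l nAx) -expr2 dnorm_sqr -frob_outer.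
apply: le_trans (dot_le_dnorm (frob ipV ipW) _ _) _.
by rewrite dnorm_outer -mulrA [X in _ * X]mulrC.
Qed.

(** With v the adjoint image of w, |v|^2 = <A v, w>, to which the bound on |A v|
   applies. *)
Lemma dnorm_adjoint A w :
  dnorm ipV (adjoint ipV ipW A w) <= dnorm (frob ipV ipW) A * dnorm ipW w.
Proof.
set v := adjoint _ _ A w.
have [->|v0] := eqVneq v 0.
  by rewrite dnorm_vec0 mulr_ge0 ?dnorm_nneg.
have nv : 0 < dnorm ipV v by rewrite sqrtr_gt0 dot_gt0.
rewrite -(ler_pM2r nv) -expr2 dnorm_sqr adjointP.
apply: le_trans (dot_le_dnorm _ _ _) _.
by rewrite mulrAC ler_wpM2r ?dnorm_nneg // dnorm_apply.
Qed.

End Outer.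

Section Orthoproj.
Context {R : realType} (V : vectType R) (ip : {dot V for idfun}) (U : {vspace V}).
Implicit Types x y : V.

Lemma dot_orthoproj x : ip x (orthoproj ip U x) = dnorm ip (orthoproj ip U x) ^+ 2.
Proof.
rewrite dnorm_sqr; apply/eqP; rewrite -subr_eq0 -dotBl.
by rewrite orthoproj_ortho ?orthoproj_mem.
Qed.

Lemma dnorm_orthoproj x : dnorm ip (orthoproj ip U x) <= dnorm ip x.
Proof.
have [->|v0] := eqVneq (orthoproj ip U x) 0; first by rewrite dnorm_vec0 dnorm_nneg.
have nv : 0 < dnorm ip (orthoproj ip U x) by rewrite sqrtr_gt0 dot_gt0.
by rewrite -(ler_pM2r nv) -expr2 -dot_orthoproj dot_le_dnorm.
Qed.

Lemma orthoproj_unique x y :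
  y \in U -> (forall z, z \in U -> ip x z = ip y z) -> orthoproj ip U x = y.
Proof.
move=> yU xy; apply/eqP; rewrite -subr_eq0; apply/eqP/(dnorm_vec0P (ip := ip))/eqP.
rewrite -sqrf_eq0 dnorm_sqr.
have dU : orthoproj ip U x - y \in U by rewrite rpredB ?orthoproj_mem.
rewrite {1}(_ : _ - y = (x - y) - (x - orthoproj ip U x)); last first.
  by rewrite opprB [RHS]addrC subrKA.
by rewrite dotBl orthoproj_ortho // subr0 dotBl xy // subrr.
Qed.

End Orthoproj.

(** * The projection onto the adapting maps *)

Section Sheaf.
Context {R : realType} {G : graph} (F : stalks R G).
Implicit Types (x : C0 F) (z : C1 F) (I : {set vertex G * edge G}).

(** The (v, e) block z_e x_v^T of the map z x^T, extended by zero to C0 -> C1. *)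
Definition incidence_part z x (p : vertex G * edge G) : 'Hom(C0 F, C1 F) :=
  outer (dotC0 F) (dsum_inj _ p.2 (Defs.dcomp p.2 z)) (dsum_inj _ p.1 (Defs.dcomp p.1 x)).

Lemma dot_dsum_inj (J : finType) (D : J -> vectType R) (ip : forall j, {dot (D j) for idfun})
    j (a : D j) (d : dsum D) : dsum_dot ip (dsum_inj D j a) d = ip j a (Defs.dcomp j d).
Proof.
rewrite /dsum_dot (bigD1 j) //= dsum_inj_id big1 ?addr0 // => i ij.
by rewrite dsum_inj_neq 1?eq_sym // dot0l.
Qed.

Lemma dotC0_inj v a x : dotC0 F (dsum_inj _ v a) x = vdot F v a (Defs.dcomp v x).
Proof. exact: dot_dsum_inj. Qed.

Lemma dotC1_inj e a z : dotC1 F (dsum_inj _ e a) z = edot F e a (Defs.dcomp e z).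
Proof. exact: dot_dsum_inj. Qed.

Lemma dotF_outer z x B : dotF F (outer (dotC0 F) z x) B = dotC1 F z (B x).
Proof. exact: frob_outer. Qed.

(** The sum lies in M because the block of each term at any other incidence is
   zero.  Pairing z x^T with a map B adds up <z_e, B_ve x_v> over all pairs
   (v, e); when B lies in M only the pairs of I contribute, and they are the
   pairings of B with the terms of the sum. *)
Lemma Pi_M_outer I z x :
  Pi_M F I (outer (dotC0 F) z x) = \sum_(p in I) incidence_part z x p.
Proof.
apply: orthoproj_unique.
  apply: rpred_sum => p pI; apply/mem_adapting_maps => v e veI.
  apply/lfunP => a; rewrite zero_lfunE !comp_lfunE /= outerE dsum_projE linearZ /=.
  have [pv|pv] := eqVneq p.1 v; last first.
    rewrite [X in X *: _](_ : _ = 0) ?scale0r //.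
    by rewrite dotC0_inj dsum_inj_neq 1?eq_sym // dotC dot0l.
  rewrite [X in _ *: X]dsum_inj_neq ?scaler0 //.
  by apply: contraNneq veI => pe; rewrite -pv -pe -surjective_pairing.
move=> B /mem_adapting_maps BI; rewrite dot_suml.
rewrite dotF_outer [X in B X](dsum_sumE x) (linear_sum B) dot_sumr.
under [RHS]eq_bigr do rewrite /incidence_part dotF_outer dotC1_inj.
rewrite [RHS]big_mkcond /=.
transitivity (\sum_v \sum_e edot F e (Defs.dcomp e z) (Defs.dcomp e (B (dsum_inj _ v (Defs.dcomp v x))))).
  by apply: eq_bigr.
rewrite pair_bigA /=; apply: eq_bigr => -[v e] _ /=.
case: ifPn => // /BI /lfunP /(_ (Defs.dcomp v x)).
by rewrite zero_lfunE !comp_lfunE /= dsum_projE => ->; rewrite dotC dot0l.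
Qed.

Lemma dnorm_Pi_M_outer I z x :
  dnorm (dotF F) (Pi_M F I (outer (dotC0 F) z x)) ^+ 2 =
  \sum_(p in I) dnorm (edot F p.2) (Defs.dcomp p.2 z) ^+ 2 * dnorm (vdot F p.1) (Defs.dcomp p.1 x) ^+ 2.
Proof.
rewrite -dot_orthoproj [X in dotF F _ X]Pi_M_outer dot_sumr; apply: eq_bigr => p _.
rewrite dotF_outer outerE dotZr dotC0_inj (dotC _ z) dotC1_inj.
by rewrite -!dnorm_sqr mulrC.
Qed.

End Sheaf.

(** * The joint dynamics *)

Section JointDynamics.
Context {R : realType} {G : graph} (F : stalks R G).
Context (S : forall v : vertex G, {vspace vstalk F v}) (I : {set vertex G * edge G}).
Context (alpha beta T B : R) (x : R -> C0 F) (delta : R -> 'Hom(C0 F, C1 F)).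
Hypotheses (alpha_gt0 : 0 < alpha) (beta_gt0 : 0 < beta).

Let time : set R := [set s | 0 <= s <= T].
Let grad t := P_Q S (adjoint (dotC0 F) (dotC1 F) (delta t) (delta t (x t))).
Let update t := Pi_M F I (outer (dotC0 F) (delta t (x t)) (x t)).

Hypothesis dx : forall t, 0 <= t <= T ->
  has_derivative_in (dotC0 F) time x t (- alpha *: grad t).
Hypothesis ddelta : forall t, 0 <= t <= T ->
  has_derivative_in (dotF F) time delta t (- beta *: update t).
Hypothesis delta_le : forall t, 0 <= t <= T -> dnorm (dotF F) (delta t) <= B.

Let z t := delta t (x t).
Let energy t := dotC1 F (z t) (z t).

Lemma disagreement_derivative t : 0 <= t <= T ->
  has_derivative_in (dotC1 F) time z t
    (- beta *: update t (x t) + delta t (- alpha *: grad t)).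
Proof.
move=> tT.
have linl (b : C0 F) : linear (fun f : 'Hom(C0 F, C1 F) => f b).
  by move=> c f g; rewrite add_lfunE scale_lfunE.
have linr (f : 'Hom(C0 F, C1 F)) : linear (fun b => f b) by move=> c a b; rewrite linearP.
have := product_rule_in (dnorm_nneg (dotC1 F)) (@dnorm_tri _ _ (dotC1 F)) linl linr
  (@dnorm_apply _ _ _ (dotC0 F) (dotC1 F)) (ddelta tT) (dx tT).
by rewrite scale_lfunE.
Qed.

(** Each flow enters phi' through the pairing of a vector with its own projection:
   <z, Pi_M (z x^T) x> is the Frobenius product of z x^T with its projection, and
   <z, delta P_Q (delta^T z)> is, by adjunction, that of delta^T z with its own. *)
Lemma energy_derivative t : 0 <= t <= T ->
  real_derivative_in time energy t
    (- (2 * beta * dnorm (dotF F) (update t) ^+ 2 + 2 * alpha * dnorm (dotC0 F) (grad t) ^+ 2)).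
Proof.
move=> tT; have := real_derivative_in_dot (disagreement_derivative tT) (disagreement_derivative tT).
rewrite (dotC _ (_ + _)) dotDr dotZr (linearZ_LR (delta t)) dotZr /=.
rewrite -[dotC1 F _ (update t _)]dotF_outer dot_orthoproj.
rewrite (dotC _ (z t) (delta t _)) -(adjointP (dotC0 F)) (dotC (dotC0 F)) dot_orthoproj.
rewrite -/(update t) -/(grad t); congr (real_derivative_in _ _ _ _); ring.
Qed.

(** Taking mu = 0 is allowed and gives the monotonicity of the energy. *)
Lemma energy_gronwall mu a b :
  (forall t, 0 <= t <= T -> mu * energy t <= dnorm (dotF F) (update t) ^+ 2) ->
  0 <= a -> a <= b -> b <= T ->
  energy b * expR (2 * beta * mu * b) <= energy a * expR (2 * beta * mu * a).
Proof.
move=> gap; apply: gronwall_in energy_derivative _ => t /gap gt.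
have : 0 <= alpha * dnorm (dotC0 F) (grad t) ^+ 2 by rewrite mulr_ge0 ?sqr_ge0 ?ltW.
have : beta * (mu * energy t) <= beta * dnorm (dotF F) (update t) ^+ 2 by rewrite ler_pM2l.
by nra.
Qed.

Lemma grad_le t : 0 <= t <= T -> dnorm (dotC0 F) (grad t) <= B * dnorm (dotC1 F) (z t).
Proof.
move=> tT; apply: le_trans (dnorm_orthoproj _ _ _) _.
apply: le_trans (dnorm_adjoint _ _ _ _) _.
by rewrite ler_wpM2r ?dnorm_nneg // delta_le.
Qed.

Lemma energyE t : energy t = dnorm (dotC1 F) (z t) ^+ 2.
Proof. by rewrite dnorm_sqr. Qed.

Lemma opinion_bounded : 0 <= T ->
  exists K, forall t, 0 <= t <= T -> dnorm (dotC0 F) (x t) ^+ 2 <= K.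
Proof.
move=> T0.
have cx : {within `[0, T], continuous (fun t => dotC0 F (x t) (x t))}.
  by apply: real_derivative_in_continuous => t tT; exact: real_derivative_in_dot (dx tT) (dx tT).
have [c _ xc] := EVT_max T0 cx.
exists (dotC0 F (x c) (x c)).
by move=> t tT; rewrite dnorm_sqr; apply: xc; rewrite in_itv.
Qed.

(** Dissipation is at most proportional to the energy: |Pi_M (z x^T)| <= |z| |x|
   and |P_Q (delta^T z)| <= B |z|.  So phi * exp (k t) is nondecreasing for
   k = 2 beta K + 2 alpha B^2, with K a bound on |x|^2; a zero of phi
   propagates backwards in time. *)
Lemma energy_backward : 0 <= T ->
  exists k, forall a b, 0 <= a -> a <= b -> b <= T ->
    energy a * expR (k * a) <= energy b * expR (k * b).
Proof.
move=> T0; have [K xK] := opinion_bounded T0.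
pose k := 2 * beta * K + 2 * alpha * B ^+ 2; exists k => a b a0 ab bT.
rewrite -lerN2 -!mulNr.
apply: (@gronwall_in _ T (fun t => - energy t) _ k a b _ _ a0 ab bT) => [t tT|t tT].
  exact: real_derivative_inN (energy_derivative tT).
have up : dnorm (dotF F) (update t) ^+ 2 <= energy t * K.
  apply: le_trans (_ : (dnorm (dotC1 F) (z t) * dnorm (dotC0 F) (x t)) ^+ 2 <= _).
    rewrite ler_sqr ?nnegrE ?mulr_ge0 ?dnorm_nneg //.
    by apply: le_trans (dnorm_orthoproj _ _ _) _; rewrite [leLHS]dnorm_outer.
  by rewrite exprMn energyE ler_wpM2l ?sqr_ge0 // xK.
have B0 : 0 <= B := le_trans (dnorm_nneg _ _) (delta_le tT).
have gr : dnorm (dotC0 F) (grad t) ^+ 2 <= B ^+ 2 * energy t.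
  by rewrite energyE -exprMn ler_sqr ?nnegrE ?mulr_ge0 ?dnorm_nneg ?grad_le.
rewrite -(ler_pM2l beta_gt0) in up; rewrite -(ler_pM2l alpha_gt0) in gr.
by rewrite /k opprK; lra.
Qed.

(** The norm of w = x(T) - x(0) is recovered from the growth of <x, w>, whose rate
   is at most |w| C exp (- k t). *)
Lemma displacement_le (C k : R) :
  0 <= T -> 0 <= C -> 0 < k ->
  (forall t, 0 <= t <= T -> alpha * dnorm (dotC0 F) (grad t) <= C * expR (- k * t)) ->
  dnorm (dotC0 F) (x T - x 0) <= C / k * (1 - expR (- (k * T))).
Proof.
move=> T0 Cge0 k0 speed; set w := x T - x 0.
have dg (t : R) : is_derive t 1 (fun s => dnorm (dotC0 F) w * (- C / k * expR (- k * s)))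
    (dnorm (dotC0 F) w * (C * expR (- k * t))).
  have := is_derive_expR_scale (- k) t => dE.
  apply: is_derive_eq; rewrite /= /GRing.scale /=; field.
  by rewrite gt_eqF.
have dxw (t : R) : 0 <= t <= T ->
    real_derivative_in time (fun s => dotC0 F (x s) w) t (dotC0 F (- alpha *: grad t) w).
  move=> tT; have := real_derivative_in_dot (dx tT) (has_derivative_in_cst _ time t w).
  by rewrite (dotC _ (x t) 0) dot0l addr0.
have := comparison_in dxw dg _ (lexx 0) T0 (lexx T).
rewrite -dotBl -/w -dnorm_sqr mulr0 expR0 => /(_ _).
have [->|w0] := eqVneq (dnorm (dotC0 F) w) 0.
  move=> _; rewrite mulr_ge0 ?divr_ge0 ?(ltW k0) // subr_ge0 -[leRHS]expR0 ler_expR.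
  by rewrite oppr_le0 mulr_ge0 // ltW.
have {}w0 : 0 < dnorm (dotC0 F) w by rewrite lt_neqAle eq_sym w0 dnorm_nneg.
move=> h; rewrite -(ler_pM2l w0) -expr2.
apply: le_trans (h _) _; last by rewrite !mulNr; lra.
move=> t tT; apply: le_trans (dot_le_dnorm _ _ _) _.
by rewrite dnorm_scale normrN gtr0_norm // mulrC ler_pM2l // speed.
Qed.

End JointDynamics.

Theorem proposition6p3 (R : realType) (G : graph) (o : orientation G)
    (F : stalks R G)
    (U : {set vertex G}) (S : forall v : vertex G, {vspace vstalk F v})
    (I : {set vertex G * edge G})
    (alpha beta T B_delta : R)
    (u : C0 F) (y0 : C0 F) (delta0 : 'Hom(C0 F, C1 F))
    (y : R -> C0 F) (delta : R -> 'Hom(C0 F, C1 F)) :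
  let x : R -> C0 F := fun t => u + y t in
  connected_graph G ->
  (forall v, v \notin U -> S v = 0%VS) ->
  (forall v e, (v, e) \in I -> v \in ends e) ->
  0 < alpha -> 0 < beta -> 0 <= T ->
  u \in C0_S S ->
  (forall t, 0 <= t <= T -> y t \in C0_Q S) ->
  (forall t, 0 <= t <= T ->
     exists rho : restriction_maps F, delta t = coboundary o rho) ->
  y 0 = y0 -> delta 0 = delta0 ->
  (forall t, 0 <= t <= T ->
     has_derivative_in (dotC0 F) [set s | 0 <= s <= T] y t
       (- alpha *: P_Q S (adjoint (dotC0 F) (dotC1 F) (delta t) (delta t (x t))))) ->
  (forall t, 0 <= t <= T ->
     has_derivative_in (dotF F) [set s | 0 <= s <= T] delta t
       (- beta *: Pi_M F I (outer (dotC0 F) (delta t (x t)) (x t)))) ->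
  0 < B_delta ->
  (ereal_sup [set (dnorm (dotF F) (delta t))%:E | t in [set t | (0 <= t <= T)%R]]
     <= B_delta%:E)%E ->
  (0 < mu_eff I T x delta)%E ->
  [/\ mu_eff I T x delta = mu_eff_sum I T x delta,
      (exists t, 0 <= t <= T /\ delta t (x t) = 0) -> x T = x 0 &
      forall mu : R, mu_eff I T x delta = mu%:E ->
        dnorm (dotC0 F) (x T - x 0)
          <= alpha * B_delta * dnorm (dotC1 F) (delta0 (u + y0)) / (beta * mu)
             * (1 - expR (- (beta * mu * T)))
          <= alpha * B_delta * dnorm (dotC1 F) (delta0 (u + y0)) / (beta * mu)].
Proof.
move=> x _ _ _ alpha0 beta0 T0 _ _ _ y00 delta00 dy ddelta B0 supB mu0.
have dx t : 0 <= t <= T ->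
    has_derivative_in (dotC0 F) [set s | 0 <= s <= T] x t
      (- alpha *: P_Q S (adjoint (dotC0 F) (dotC1 F) (delta t) (delta t (x t)))).
  by move=> tT; exact: has_derivative_in_addl (dy t tT).
have delta_le t : 0 <= t <= T -> dnorm (dotF F) (delta t) <= B_delta.
  move=> tT; rewrite -lee_fin; apply: le_trans supB.
  by apply: ereal_sup_ubound; exists t.
have growth := energy_gronwall alpha0 beta0 dx ddelta.
have gradP := grad_le S x delta_le.
have displacement := displacement_le alpha0 dx.
split.
- rewrite /mu_eff /mu_eff_sum; congr ereal_inf; apply: eq_imagel => t _.
  by rewrite dnorm_Pi_M_outer.
- move=> [t0 [t0T zt0]].
  have z0 t : 0 <= t <= T -> delta t (x t) = 0.
    move=> tT; apply: (dnorm_vec0P (ip := dotC1 F)); apply/eqP.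
    rewrite -sqrf_eq0 dnorm_sqr eq_le dot_ge0 andbT.
    have /andP[t0_ge0 t0_leT] := t0T; have /andP[t_ge0 t_leT] := tT.
    have [tt0|t0t] := leP t t0.
      have [k back] := energy_backward alpha0 beta0 dx ddelta delta_le T0.
      have := back t t0 t_ge0 tt0 t0_leT.
      by rewrite zt0 dot0l mul0r pmulr_lle0 // expR_gt0.
    (* For mu = 0 the spectral-gap hypothesis of growth is trivial. *)
    have := growth 0 t0 t _ t0_ge0 (ltW t0t) t_leT.
    rewrite zt0 dot0l mul0r pmulr_lle0 ?expR_gt0 //; apply => s _.
    by rewrite mul0r sqr_ge0.
  apply/eqP; rewrite -subr_eq0; apply/eqP/(dnorm_vec0P (ip := dotC0 F))/eqP.
  rewrite eq_le dnorm_nneg andbT.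
  (* The speed is zero, so the bound holds with constant 0 and any rate. *)
  have := displacement 0 1 T0 (lexx 0) ltr01; rewrite !mul0r; apply => t tT.
  have := gradP t tT; rewrite z0 // dnorm_vec0 mulr0 mul0r => gt.
  by rewrite pmulr_rle0.
- move=> mu muE; rewrite muE lte_fin in mu0.
  have bm : 0 < beta * mu by rewrite mulr_gt0.
  rewrite -delta00 -y00 -/(x 0); set z0 := dnorm _ (delta 0 (x 0)).
  have C_ge0 : 0 <= alpha * B_delta * z0 by rewrite !mulr_ge0 ?dnorm_nneg ?ltW.
  apply/andP; split; last first.
    by rewrite ler_piMr ?divr_ge0 ?(ltW bm) // gerBl expR_ge0.
  apply: displacement => // t tT; rewrite -!mulrA ler_pM2l //.
  apply: le_trans (gradP t tT) _; rewrite ler_pM2l //.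
  have gap s : 0 <= s <= T -> mu * dotC1 F (delta s (x s)) (delta s (x s)) <=
      dnorm (dotF F) (Pi_M F I (outer (dotC0 F) (delta s (x s)) (x s))) ^+ 2.
    move=> sT; have [zs|zs] := eqVneq (delta s (x s)) 0.
      by rewrite {1}zs dot0l mulr0 sqr_ge0.
    rewrite -ler_pdivlMr ?dot_gt0 // -lee_fin -muE -dnorm_sqr.
    by apply: ereal_inf_lbound; exists s.
  have /andP[t_ge0 t_leT] := tT.
  have := growth mu 0 t gap (lexx 0) t_ge0 t_leT.
  rewrite mulr0 expR0 mulr1 -!dnorm_sqr -/z0 => decay.
  rewrite mulNr expRN ler_pdivlMr ?expR_gt0 //.
  rewrite -ler_sqr ?nnegrE ?mulr_ge0 ?dnorm_nneg ?expR_ge0 //.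
  by rewrite exprMn -expRM_natl !mulrA.
Qed.
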